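(* Let $x,y$ be roots of unity and $p,q\ge1$ integers with $(p,y)\neq(1,1)$ and $(q,xy)\neq(1,1)$. Then \begin{align*} &(xy)^{-1}R_{p;q}\big(y;(xy)^{-1}\big)-(-1)^{p+q}R_{p;q}\big(y^{-1};xy\big)\\ &=\mathrm{Li}_p(y)\mathrm{ti}_q\big((xy)^{-1}\big)+(-1)^q(xy)^{-1}\mathrm{Li}_p(y)\mathrm{ti}_q(xy)+(-1)^q\binom{p+q-1}{p}(xy)^{-1}\mathrm{ti}_{p+q}(xy)\\ &\quad+(-1)^q(xy)^{-1}\sum_{m=0}^{p-1}\binom{p+q-m-2}{q-1}\Big((-1)^m\mathrm{Li}_{m+1}(x)-\mathrm{Li}_{m+1}(x^{-1})\Big)\mathrm{ti}_{p+q-m-1}(xy)\\ &\quad+(-1)^qy^{-1}\sum_{m=0}^{q-1}\binom{p+q-m-2}{p-1}\mathrm{ti}_{p+q-m-1}(y)\Big((-1)^m\mathrm{ti}_{m+1}(x^{-1})-x^{-1}\mathrm{ti}_{m+1}(x)\Big). \end{align*}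
   Context: For $p\in\mathbb{N}$, $n\ge0$, root of unity $z$: $\zeta_n(p;z)=\sum_{k=1}^n z^k/k^p$ (empty sum $0$). For $|z|\le1$, $(m,z)\ne(1,1)$: $\mathrm{Li}_m(z)=\sum_{n\ge1}z^n/n^m$, $\mathrm{ti}_m(z)=\sum_{n\ge1}z^n/(n-1/2)^m$. For positive integers $p,q$ and roots of unity $z_1,z$ with $(q,z)\ne(1,1)$: $R_{p;q}(z_1;z)=\sum_{n\ge0}\frac{\zeta_n(p;z_1)}{(n+1/2)^q}z^n$. *)

(* Defs.v *)
From HB Require Import structures.
From mathcomp Require Import all_boot all_order all_algebra.
From mathcomp Require Import complex.
From mathcomp Require Import all_classical all_reals all_analysis.

Set Implicit Arguments.
Unset Strict Implicit.
Unset Printing Implicit Defensive.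

Import Order.TTheory GRing.Theory Num.Theory.
Import numFieldNormedType.Exports.

Local Open Scope ring_scope.

Definition is_root_of_unity (F : nzRingType) (z : F) : Prop :=
  exists2 n : nat, (0 < n)%N & n.-unity_root z.

(* The sum of a possibly only conditionally convergent series is the limit of
   its partial sums.  The topology of the complex numbers is the one carried
   by R[i]^o. *)
Definition csum (R : realType) (u : nat -> R[i]) : R[i] :=
  limn (series (u : nat -> R[i]^o)).

Definition zeta_sum (R : realType) (n p : nat) (z : R[i]) : R[i] :=
  \sum_(1 <= k < n.+1) z ^+ k / k%:R ^+ p.

(* The general term of a series over n >= 1 is written at n.+1.  For
   (m, z) = (1, 1) both series diverge and [Li], [ti] have an unspecified
   value; in the difference of two copies of it, that value cancels. *)
Definition Li (R : realType) (m : nat) (z : R[i]) : R[i] :=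
  csum (fun n => z ^+ n.+1 / n.+1%:R ^+ m).

Definition ti (R : realType) (m : nat) (z : R[i]) : R[i] :=
  csum (fun n => z ^+ n.+1 / (n.+1%:R - 2%:R^-1) ^+ m).

Definition Rsum (R : realType) (p q : nat) (z1 z : R[i]) : R[i] :=
  csum (fun n => zeta_sum n p z1 / (n%:R + 2%:R^-1) ^+ q * z ^+ n).

(* Main.v *)
(* Put w = (xy)^-1 and, for an integer k <> 0 and a half-integer N,
   f(k, N) = y^k w^(N+1/2) / (k^p N^q).  The left-hand side is the sum of f over
   0 < k < N minus its sum over N < k < 0, and Li_p(y) times the two ti_q's is
   the sum of f over k > 0 and all N; the difference is thus the sum of f over
   all pairs with N < k.  Summed along the lines k - N = j, each line is
   evaluated by partial fractions in k, which gives bilateral Li and ti values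
   times powers of 1/j, and the sum over j > 0 yields the right-hand side.
   The series converge only conditionally, so the two orders of summation are
   compared on the strip 0 < k - N < J: as both sums over k have tails O(1/n),
   the error is O((1 + 1/2 + ... + 1/J) / J). *)

Require Import Defs.
From HB Require Import structures.
From mathcomp Require Import all_boot all_order all_algebra.
From mathcomp Require Import complex.
From mathcomp Require Import all_classical all_reals all_analysis.
From mathcomp Require Import ring zify.

Set Implicit Arguments.
Unset Strict Implicit.
Unset Printing Implicit Defensive.

Import Order.TTheory GRing.Theory Num.Theory.
Import numFieldNormedType.Exports.
Local Open Scope ring_scope.
Local Open Scope classical_set_scope.
Local Open Scope complex_scope.

(** * Limits of complex sequences, with rates *)

Section ComplexSequences.
Variable R : realType.
Implicit Types (u v : nat -> R[i]) (a b c l : R[i]).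

Definition cvgC u l : Prop := (u : nat -> R[i]^o) @ \oo --> (l : R[i]^o).

Lemma cvgC_cst a : cvgC (fun=> a) a.
Proof. exact: cvg_cst. Qed.

Lemma cvgC_add u v a b :
  cvgC u a -> cvgC v b -> cvgC (fun n => u n + v n) (a + b).
Proof. exact: cvgD. Qed.

Lemma cvgC_mull c u a : cvgC u a -> cvgC (fun n => c * u n) (c * a).
Proof.
move=> h.
exact: (@cvgM _ _ _ _ (cst c : nat -> R[i]^o) u c a (cvg_cst _) h).
Qed.

Lemma cvgC_sub u v a b :
  cvgC u a -> cvgC v b -> cvgC (fun n => u n - v n) (a - b).
Proof. exact: cvgB. Qed.

Lemma cvgC_sum (k : nat) (F : nat -> nat -> R[i]) (f : nat -> R[i]) :
  (forall i, (i < k)%N -> cvgC (F i) (f i)) ->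
  cvgC (fun n => \sum_(0 <= i < k) F i n) (\sum_(0 <= i < k) f i).
Proof.
elim: k => [|k IH] h.
  rewrite big_nil (_ : (fun n => _) = fun=> 0); first exact: cvgC_cst.
  by apply/funext => n; rewrite big_nil.
rewrite big_nat_recr //= (_ : (fun n => _) =
  fun n => \sum_(0 <= i < k) F i n + F k n); last first.
  by apply/funext => n; rewrite big_nat_recr.
by apply: cvgC_add; [apply: IH => i ik; exact/h/ltnW | exact: h].
Qed.

Lemma cvgC_unique u a b : cvgC u a -> cvgC u b -> a = b.
Proof. exact: (@cvg_unique _ (@norm_hausdorff _ _)). Qed.

Lemma cvgC_csum u a :
  cvgC (fun n => \sum_(0 <= k < n) u k) a -> csum u = a.
Proof. exact: (@cvg_lim _ (@norm_hausdorff _ _)). Qed.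

Lemma cvgC_shift u a : cvgC u a <-> cvgC (fun n => u n.+1) a.
Proof.
split => h; last by rewrite /cvgC -cvg_shiftS.
by move: h; rewrite /cvgC -[X in X -> _]cvg_shiftS.
Qed.

(** A positive element of [R[i]] is real, so it is enough to test with tolerances taken in [R]. *)
Lemma cvgCP u l : cvgC u l <->
  forall e : R, 0 < e -> \forall n \near \oo, `|u n - l| <= e%:C.
Proof.
split.
  move=> /cvgrPdist_le h e e0.
  have := h e%:C; rewrite ltcR => /(_ e0).
  by apply: filterS => n; rewrite distrC.
move=> h; apply/cvgrPdist_le => e e0.
have er : (complex.Re e)%:C = e by apply: RRe_real; exact: gtr0_real.
have := h (complex.Re e); rewrite -ltcR er => /(_ e0).
by apply: filterS => n; rewrite distrC.
Qed.

Lemma cvgC_squeeze u v l :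
  (forall n, `|u n - l| <= v n) -> cvgC v 0 -> cvgC u l.
Proof.
move=> uv /cvgCP v0; apply/cvgCP => e /v0; apply: filterS => n.
rewrite subr0 => h; apply: le_trans (uv n) (le_trans _ h).
by rewrite ger0_norm // (le_trans _ (uv n)).
Qed.

Lemma cvgC_dist_le u l a e N : cvgC u l ->
  (forall n, (N <= n)%N -> `|u n - a| <= e) -> `|l - a| <= e.
Proof.
move=> ul ua.
(* The order of [R[i]] is partial: [<=] can be negated into [<] only once [e] is known to be
   real. *)
have er : e \is Num.real.
  by apply: ger0_real; apply: le_trans (ua N (leqnn N)).
rewrite real_leNgt ?normr_real //; apply/negP => lt.
move/cvgrPdist_lt: ul => /(_ (`|l - a| - e)); rewrite subr_gt0 => /(_ lt)[M _ h].
have := h (maxn N M) (leq_maxr _ _); have := ua (maxn N M) (leq_maxl _ _).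
set w := u _ => h1 h2.
have : `|l - a| < `|l - a|.
  rewrite -{2}[`|l - a|](subrK e); apply: le_lt_trans (ler_distD w _ _) _.
  exact: ltr_leD.
by rewrite ltxx.
Qed.

Lemma cvgC_real (r : nat -> R) (s : R) :
  r @ \oo --> s -> cvgC (fun n => (r n)%:C) s%:C.
Proof.
move=> /cvgrPdist_le h; apply/cvgCP => e /h; apply: filterS => n.
rewrite -rmorphB /= normc_def /= expr0n addr0 sqrtr_sqr lecR.
by rewrite distrC.
Qed.

Lemma cvgC_inv_natS : cvgC (fun n => n.+1%:R^-1) 0.
Proof.
have := cvgC_real (@cvg_harmonic R).
by congr cvgC; apply/funext => n; rewrite /= fmorphV rmorph_nat.
Qed.

(** Cesaro's theorem for the harmonic sequence. This mean is the main error term when the two orders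
    of summation are compared. *)
Lemma cvgC_harmonic_mean :
  cvgC (fun n => n.+1%:R^-1 * \sum_(0 <= k < n.+1) k.+1%:R^-1) 0.
Proof.
have := cvgC_real (cesaro (@cvg_harmonic R)).
congr cvgC; apply/funext => n; rewrite /arithmetic_mean seriesEnat /=.
rewrite rmorphM fmorphV rmorph_nat rmorph_sum; congr (_ * _).
by apply: eq_bigr => k _; rewrite fmorphV rmorph_nat.
Qed.

Lemma normc_ge_Im (z : R[i]) : `|complex.Im z|%:C <= `|z|.
Proof.
rewrite normc_def lecR -sqrtr_sqr ler_sqrt ?addr_ge0 ?sqr_ge0 //.
by rewrite lerDr sqr_ge0.
Qed.

Lemma real_cauchy_cvg (r : nat -> R) (M : R) :
  (forall n m, (n <= m)%N -> `|r m - r n| <= M / n.+1%:R) -> cvgn r.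
Proof.
move=> h; apply/cauchy_cvgP.
suff : cauchy_ex (r @ \oo) by exact: cauchy_exP.
move=> e e0.
have /cvgrPdist_lt/(_ e e0)[N _ hN] : (fun n => M / n.+1%:R) @ \oo --> (0 : R).
  by rewrite -(mulr0 M); apply: cvgMl_tmp; exact: cvg_harmonic.
exists (r N); exists N => // m /= Nm.
rewrite -ball_normE /ball_ /= distrC; apply: le_lt_trans (h _ _ Nm) _.
have := hN N (leqnn N); rewrite /= sub0r normrN.
by apply: le_lt_trans; exact: ler_norm.
Qed.

(** Completeness of [R] is applied to the real and imaginary parts. The rate passes to the limit,
    which supplies the O(1/n) tails used later. *)
Lemma cvgC_cauchy u c :
  (forall n m, (n <= m)%N -> `|u m - u n| <= c / n.+1%:R) ->
  exists2 l, cvgC u l & forall n, `|u n - l| <= c / n.+1%:R.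
Proof.
move=> h.
have c0 : 0 <= c by have := h 0 0 isT; rewrite divr1; apply: le_trans.
have cr : (complex.Re c)%:C = c by apply: RRe_real; exact: ger0_real.
have bound n : (complex.Re c / n.+1%:R)%:C = c / n.+1%:R.
  by rewrite -[in RHS]cr rmorphM fmorphV rmorph_nat.
have /cvg_ex[a ca] : cvgn (fun n => complex.Re (u n)).
  apply: (@real_cauchy_cvg _ (complex.Re c)) => n m nm; rewrite -lecR bound.
  apply: le_trans (h _ _ nm); apply: le_trans (normc_ge_Re _).
  by rewrite lecR; case: (u n) (u m) => [? ?] [? ?].
have /cvg_ex[b cb] : cvgn (fun n => complex.Im (u n)).
  apply: (@real_cauchy_cvg _ (complex.Re c)) => n m nm; rewrite -lecR bound.
  apply: le_trans (h _ _ nm); apply: le_trans (normc_ge_Im _).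
  by rewrite lecR; case: (u n) (u m) => [? ?] [? ?].
have ul : cvgC u (a%:C + 'i%C * b%:C).
  rewrite (_ : u = fun n => (complex.Re (u n))%:C + 'i%C * (complex.Im (u n))%:C).
    by apply: cvgC_add; [exact: cvgC_real | exact/cvgC_mull/cvgC_real].
  by apply/funext => n; rewrite -complexE.
exists (a%:C + 'i%C * b%:C) => // n; rewrite distrC.
by apply: (@cvgC_dist_le u _ _ _ n) => // m nm; exact: h.
Qed.

End ComplexSequences.

Arguments cvgC_mull [R] c [u a].

(** * Tails of power series on the unit circle *)

Section PowerTails.
Variable C : numFieldType.
Implicit Types (z d : C) (v : nat -> C).

Lemma root_of_unity_norm z : is_root_of_unity z -> `|z| = 1.
Proof.
case=> n n0 /unity_rootP zn; apply/eqP.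
by rewrite -(@pexpr_eq1 _ _ n) // -normrX zn normr1.
Qed.

(** Multiplication by [1 - z] telescopes the sum. The bound is uniform in [n] and [N], as summation
    by parts requires. *)
Lemma geometric_sum_le z n N : `|z| = 1 -> z != 1 -> (n <= N)%N ->
  `|\sum_(n <= k < N) z ^+ k| <= 2%:R / `|1 - z|.
Proof.
move=> z1 zn1 nN.
have dz : 0 < `|1 - z| by rewrite normr_gt0 subr_eq0 eq_sym.
rewrite ler_pdivlMr // -normrM mulr_suml.
rewrite (eq_bigr (fun k => - z ^+ k.+1 - - z ^+ k)); last first.
  by move=> k _; rewrite exprS; ring.
rewrite (telescope_sumr (fun k => - z ^+ k)) // opprK.
by apply: le_trans (ler_normD _ _) _; rewrite normrN !normrX z1 !expr1n.
Qed.

(** Summation by parts: the weights [v k - v k.+1] are nonnegative and telescope, so cancellation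
    inside [u] is kept. *)
Lemma abel_sum_le (u : nat -> C) v B n N : (n <= N)%N ->
  (forall k, 0 <= v k) -> (forall k, v k.+1 <= v k) ->
  (forall m, (n <= m)%N -> `|\sum_(n <= k < m) u k| <= B) ->
  `|\sum_(n <= k < N) u k * v k| <= B * v n.
Proof.
move=> nN v0 vS hB.
pose P m := \sum_(n <= k < m) u k.
have abel : \sum_(n <= k < N) u k * v k =
    P N * v N + \sum_(n <= k < N) P k.+1 * (v k - v k.+1).
  elim: N nN => [|N IH]; first by rewrite leqn0 => /eqP->; rewrite /P !big_geq // mul0r addr0.
  rewrite leq_eqVlt => /orP[/eqP <-|]; first by rewrite /P !big_geq // mul0r addr0.
  rewrite ltnS => nN; rewrite !big_nat_recr //= IH // /P big_nat_recr //=; ring.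
have B0 : 0 <= B by apply: le_trans (hB n (leqnn n)).
rewrite abel; apply: le_trans (ler_normD _ _) _.
have -> : B * v n = B * v N + \sum_(n <= k < N) B * (v k - v k.+1).
  rewrite -mulr_sumr -mulrDr; congr (_ * _).
  under eq_bigr do rewrite -opprB.
  by rewrite sumrN telescope_sumr // opprB addrC subrK.
apply: lerD; first by rewrite normrM (ger0_norm (v0 N)) ler_wpM2r ?hB.
apply: le_trans (ler_norm_sum _ _ _) _.
rewrite big_nat_cond [leRHS]big_nat_cond; apply: ler_sum => k /andP[/andP[nk _] _].
have d0 : 0 <= v k - v k.+1 by rewrite subr_ge0.
by rewrite normrM (ger0_norm d0) ler_wpM2r // hB // (leq_trans nk).
Qed.

(** Each term is at most [2 (1/(k+1) - 1/(k+2))], which telescopes. *)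
Lemma inverse_square_sum_le n N : (n <= N)%N ->
  \sum_(n <= k < N) (k.+1%:R ^+ 2)^-1 <= 2%:R / n.+1%:R :> C.
Proof.
move=> nN.
have h k : (k.+1%:R ^+ 2)^-1 <= 2%:R * (k.+1%:R^-1 - k.+2%:R^-1) :> C.
  have -> : k.+1%:R^-1 - k.+2%:R^-1 = (k.+1%:R * k.+2%:R)^-1 :> C.
    by field; rewrite -[1]/(1%:R) -!natrD !pnatr_eq0.
  rewrite -[leLHS]mul1r ler_pdivrMr ?exprn_gt0 ?ltr0n // mulrAC.
  rewrite ler_pdivlMr ?mulr_gt0 ?ltr0n // mul1r expr2 -!natrM ler_nat; nia.
apply: le_trans (ler_sum _ (fun k _ => h k)) _.
rewrite -mulr_sumr ler_wpM2l //.
under eq_bigr do rewrite -opprB.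
rewrite sumrN (telescope_sumr (fun k => k.+1%:R^-1 : C)) // opprB.
by rewrite lerBlDr lerDl invr_ge0.
Qed.

(* The general term of [Li] for [d = 0] and of [ti] for [d = 1/2]. *)
Definition pow_term d m z n : C := z ^+ n.+1 / (n.+1%:R - d) ^+ m.

(** Since [d <= 1/2 <= (n+1)/2], the shift costs at most a factor 2 against [n + 1]. *)
Lemma shifted_ge d n : 0 <= d <= 2%:R^-1 -> n.+1%:R / 2%:R <= n.+1%:R - d.
Proof.
move=> /andP[d0 d1]; rewrite lerBrDr.
apply: le_trans (lerD (lexx _) d1) _.
rewrite -{2}[2%:R^-1]mul1r -mulrDl ler_pdivrMr ?ltr0n // -[1]/(1%:R) -natrD -natrM ler_nat; lia.
Qed.

Lemma shifted_gt0 d n : 0 <= d <= 2%:R^-1 -> 0 < n.+1%:R - d.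
Proof.
by move=> hd; apply: lt_le_trans (shifted_ge n hd); rewrite divr_gt0 ?ltr0n.
Qed.

Lemma shifted_inv_le d n : 0 <= d <= 2%:R^-1 ->
  (n.+1%:R - d)^-1 <= 2%:R / n.+1%:R.
Proof.
move=> hd; rewrite -[2%:R / _]invrK lef_pV2 ?posrE ?invr_gt0 ?divr_gt0 ?ltr0n ?shifted_gt0 //.
by rewrite invf_div shifted_ge.
Qed.

Lemma pow_term_norm_le d m z n : 0 <= d <= 2%:R^-1 -> `|z| = 1 ->
  `|pow_term d m z n| <= 2%:R ^+ m / n.+1%:R ^+ m.
Proof.
move=> hd z1; rewrite /pow_term normrM normrX z1 expr1n mul1r normfV normrX.
rewrite (gtr0_norm (shifted_gt0 n hd)) -expr_div_n -exprVn.
have h := shifted_gt0 n hd; apply: lerXn2r; last exact: shifted_inv_le.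
  by rewrite nnegrE invr_ge0 ltW.
by rewrite nnegrE divr_ge0.
Qed.

Lemma pow_term_norm_le1 d m z n : 0 <= d <= 2%:R^-1 -> `|z| = 1 -> (0 < m)%N ->
  `|pow_term d m z n| <= 2%:R ^+ m / n.+1%:R.
Proof.
move=> hd z1 m0; apply: le_trans (pow_term_norm_le m n hd z1) _.
rewrite ler_wpM2l ?exprn_ge0 // lef_pV2 ?posrE ?exprn_gt0 ?ltr0n //.
by rewrite -natrX ler_nat -{1}(expn1 n.+1) leq_pexp2l.
Qed.

(** If [z = 1], then [m >= 2] and inverse squares dominate. Otherwise summation by parts against
    geometric sums gives the same rate, even for [m = 1]. *)
Lemma pow_term_tail d m z : 0 <= d <= 2%:R^-1 -> `|z| = 1 -> (0 < m)%N ->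
  (m, z) <> (1%N, 1) ->
  exists2 B, 0 <= B & forall n N, (n <= N)%N ->
    `|\sum_(n <= k < N) pow_term d m z k| <= B / n.+1%:R.
Proof.
move=> hd z1 m0 mz.
have [zE|zn1] := eqVneq z 1.
  have m2 : (2 <= m)%N.
    by case: m m0 mz => [|[|m]] // _ mz; case: mz; rewrite zE.
  exists (2%:R ^+ m * 2%:R); first by rewrite mulr_ge0 ?exprn_ge0.
  move=> n N nN; apply: le_trans (ler_norm_sum _ _ _) _.
  rewrite -mulrA; apply: le_trans _ (ler_wpM2l _ (inverse_square_sum_le nN)).
    rewrite mulr_sumr; apply: ler_sum => k _.
    apply: le_trans (pow_term_norm_le m k hd z1) _.
    rewrite ler_wpM2l ?exprn_ge0 // lef_pV2 ?posrE ?exprn_gt0 ?ltr0n //.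
    by rewrite -!natrX ler_nat leq_pexp2l.
  by rewrite exprn_ge0.
(* The first factor bounds the geometric sums; [2 ^ m] is the price of replacing [n + 1 - d] by
   [n + 1]. *)
exists (2%:R / `|1 - z| * 2%:R ^+ m); first by rewrite mulr_ge0 ?divr_ge0 ?exprn_ge0.
move=> n N nN.
pose v k := ((k.+1%:R - d) ^+ m)^-1 : C.
have -> : \sum_(n <= k < N) pow_term d m z k = z * \sum_(n <= k < N) z ^+ k * v k.
  by rewrite mulr_sumr; apply: eq_bigr => k _; rewrite /pow_term exprS mulrA.
rewrite normrM z1 mul1r.
apply: (@le_trans _ _ (2%:R / `|1 - z| * v n)).
  apply: abel_sum_le => //.
  - by move=> k; rewrite /v invr_ge0 exprn_ge0 // ltW // shifted_gt0.
  - move=> k; rewrite /v lef_pV2 ?posrE ?exprn_gt0 ?shifted_gt0 //.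
    apply: lerXn2r; rewrite ?nnegrE; try by rewrite ltW ?shifted_gt0.
    by rewrite lerD2r ler_nat.
  - by move=> M nM; apply: geometric_sum_le.
rewrite -[leRHS]mulrA ler_wpM2l ?divr_ge0 //.
have := pow_term_norm_le1 n hd (normr1 _) m0.
rewrite /pow_term expr1n mul1r -/(v n) ger0_norm //.
by rewrite /v invr_ge0 exprn_ge0 // ltW // shifted_gt0.
Qed.

End PowerTails.

(** * Partial fractions with binomial coefficients *)

Section PartialFractions.

(** Up to sign, the part at the pole [k = 0] of [1 / (k^p b^q)] for [k = a + b], where [U] and [W]
    stand for [1/k] and [1/a]. *)
Definition pf_sum (A : comNzRingType) (W U : A) (p q : nat) : A :=
  \sum_(0 <= s < p) 'C((q + s).-1, s)%:R * W ^+ (q + s) * U ^+ (p - s).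

(** Pascal's rule, term by term. *)
Lemma pf_sumS (A : comNzRingType) (W U : A) p q :
  pf_sum W U p.+1 q.+1 = W * (pf_sum W U p q.+1 + pf_sum W U p.+1 q).
Proof.
rewrite /pf_sum big_nat_recl // [in X in _ = _ * (_ + X)]big_nat_recl //=.
rewrite !addn0 !bin0 !subn0 addrCA mulrDr; congr (_ + _).
  by rewrite exprS; ring.
rewrite -big_split /= mulr_sumr; apply: eq_bigr => s _.
rewrite addSn /= !addnS /= binS natrD !addSn !subSS !exprS; ring.
Qed.

(** The relation, which holds for the inverses of [k], [b] and [a = k - b], trades a product for
    terms with [p] or [q] lowered by one, and [pf_sumS] is the same recursion. For [p = q = 0] both
    sums would be empty while the product is 1. *)
Lemma partial_fractions_ring (A : comNzRingType) (U V W : A) p q :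
  U * V = W * (V - U) -> (0 < p + q)%N ->
  U ^+ p * V ^+ q =
    (-1) ^+ q * pf_sum W U p q + (-1) ^+ p * pf_sum (- W) V q p.
Proof.
move=> UV; elim: p q => [|p IHp] q.
  (* When one exponent is 0, the binomials ['C(s.-1, s)] vanish except at [s = 0]. *)
  case: q => // q _; rewrite /pf_sum big_geq // big_nat_recl //=.
  rewrite !bin0 !subn0 big1 => [|s _]; last by rewrite bin_small // !mul0r.
  by rewrite expr0; ring.
elim: q => [|q IHq] _.
  rewrite /pf_sum [in X in _ + X]big_geq // big_nat_recl //=.
  rewrite !bin0 !subn0 big1 => [|s _]; last by rewrite bin_small // !mul0r.
  by rewrite !expr0; ring.
have -> : U ^+ p.+1 * V ^+ q.+1 = W * (U ^+ p * V ^+ q.+1 - U ^+ p.+1 * V ^+ q).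
  transitivity (U ^+ p * V ^+ q * (U * V)); first by rewrite !exprS; ring.
  by rewrite UV !exprS; ring.
rewrite IHp ?addnS // IHq ?addSn // !pf_sumS [(-1) ^+ q.+1]exprS [(-1) ^+ p.+1]exprS.
ring.
Qed.

Lemma pf_sum_rev (A : comNzRingType) (W U : A) p q : (0 < q)%N ->
  pf_sum W U p q = \sum_(0 <= m < p)
    'C(p + q - m - 2, q - 1)%:R * W ^+ (p + q - m - 1) * U ^+ m.+1.
Proof.
move=> q0; rewrite /pf_sum big_nat_rev /=; apply: eq_big_nat => m /andP[_ mp].
have -> : (0 + p - m.+1 = p - m.+1)%N by lia.
have e1 : ((q + (p - m.+1)).-1 = p + q - m - 2)%N by lia.
rewrite e1 -bin_sub; last by lia.
congr (_ * _ * _).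
- by congr ('C(_, _)%:R); lia.
- by congr (_ ^+ _); lia.
- by congr (_ ^+ _); lia.
Qed.

(** This produces the binomial coefficient in front of [ti (p + q)]. *)
Lemma sum_bin_hockey_stick p q : (0 < p)%N -> (0 < q)%N ->
  (\sum_(0 <= m < q) 'C(p + q - m - 2, p - 1) = 'C(p + q - 1, p))%N.
Proof.
case: p => // p _; case: q => // q _; rewrite big_nat_rev /=.
rewrite (eq_big_nat _ _ (F2 := fun m => 'C(p + m, p))); last first.
  by move=> m /andP[_ mq]; congr 'C(_, _); lia.
rewrite (_ : p.+1 + q.+1 - 1 = (p + q).+1)%N; last by lia.
elim: q => [|q IH]; first by rewrite big_nat1 !addn0 !binn.
by rewrite big_nat_recr //= IH addnS [in RHS]binS addnC.
Qed.

(* With [0^-1 = 0] the left-hand side vanishes at [k = 0] whereas the partial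
   fractions do not: this is where the term with [ti (p + q)] comes from. *)
Lemma partial_fractions (F : fieldType) (k a b : F) p q :
  (0 < p)%N -> (0 < q)%N -> a != 0 -> b != 0 -> k = a + b ->
  (k ^+ p)^-1 * (b ^+ q)^-1 =
    (-1) ^+ q * \sum_(0 <= m < p)
      'C(p + q - m - 2, q - 1)%:R * (a ^+ (p + q - m - 1))^-1 * (k ^+ m.+1)^-1
  - (-1) ^+ q * \sum_(0 <= m < q)
      'C(p + q - m - 2, p - 1)%:R * (a ^+ (p + q - m - 1))^-1
      * ((-1) ^+ m * (b ^+ m.+1)^-1)
  - (k == 0)%:R * ((-1) ^+ q * 'C(p + q - 1, p)%:R * (a ^+ (p + q))^-1).
Proof.
move=> p0 q0 a0 b0 kE.
have [k0|k0] := eqVneq k 0.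
  (* Here the first sum vanishes, and as [b = - a] each term of the second is a binomial times
     [- a^-(p+q)]; the hockey-stick identity adds them up to the correction term. *)
  have bE : b = - a by apply/eqP; rewrite -addr_eq0 addrC -kE k0.
  rewrite k0 expr0n eqn0Ngt p0 invr0 !mul0r big1 => [|m _]; last first.
    by rewrite expr0n invr0 mulr0.
  rewrite mulr0 sub0r mul1r -mulrA -mulrN -mulrBr.
  rewrite -(sum_bin_hockey_stick p0 q0) natr_sum mulr_suml -opprD -big_split /=.
  rewrite big_nat big1 ?oppr0 ?mulr0 // => m /andP[_ mq].
  have eE : (p + q = (p + q - m - 1) + m.+1)%N by lia.
  have sgn : (-1) ^+ m * (b ^+ m.+1)^-1 = - (a ^+ m.+1)^-1.
    by rewrite bE [(- a) ^+ _]exprNn [(-1) ^+ m.+1]exprS mulN1r mulNr invrN invfM invr_sign mulrN signrMK.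
  by rewrite sgn [in X in _ + _ * X]eE exprD invfM; ring.
rewrite !mul0r subr0 -!exprVn.
rewrite (@partial_fractions_ring _ k^-1 b^-1 a^-1); first last.
- by rewrite addn_gt0 p0.
- by move: k0; rewrite kE => k0; field; rewrite a0 b0 k0.
rewrite !pf_sum_rev // ; congr (_ + _).
  by congr (_ * _); apply: eq_bigr => m _; rewrite !exprVn.
rewrite [(q + p)%N]addnC !mulr_sumr -sumrN; apply: eq_big_nat => m /andP[_ mq].
rewrite [(- a^-1) ^+ _]exprNn !exprVn.
(* Both sides carry an exponent with the parity of [q + m + 1], as [m < q]. *)
have sgn : (-1) ^+ p * (-1) ^+ (p + q - m - 1) = - ((-1) ^+ q * (-1) ^+ m) :> F.
  rewrite -!exprD -[RHS]mulN1r -exprS -signr_odd -[RHS]signr_odd.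
  by congr (_ ^+ nat_of_bool _); lia.
rewrite [RHS](_ : _ = - ((-1) ^+ q * (-1) ^+ m) * ('C(p + q - m - 2, p - 1)%:R
  * (a ^+ (p + q - m - 1))^-1 * (b ^+ m.+1)^-1)); last by ring.
by rewrite -sgn; ring.
Qed.

End PartialFractions.

(** * Convergence of the series [Li], [ti] and [Rsum] *)

Section PolylogSeries.
Variable R : realType.
Implicit Types (x z : R[i]).

Let half_bounds : 0 <= (2%:R^-1 : R[i]) <= 2%:R^-1.
Proof. by rewrite lexx invr_ge0 ler0n. Qed.

Let zero_bounds : 0 <= (0 : R[i]) <= 2%:R^-1.
Proof. by rewrite lexx invr_ge0 ler0n. Qed.

Lemma pow_series_cvg (d : R[i]) m z : 0 <= d <= 2%:R^-1 -> `|z| = 1 ->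
  (0 < m)%N -> (m, z) <> (1%N, 1) ->
  let s n := \sum_(0 <= k < n) pow_term d m z k in
  exists2 B, cvgC s (csum (pow_term d m z)) &
    forall n, `|s n - csum (pow_term d m z)| <= B / n.+1%:R.
Proof.
move=> hd z1 m0 mz s; have [B B0 hB] := pow_term_tail hd z1 m0 mz.
have [n N nN|l sl hl] := @cvgC_cauchy R s B.
  rewrite /s (big_cat_nat (n := n)) //= addrAC subrr add0r; exact: hB.
by exists B; rewrite (cvgC_csum sl).
Qed.

Lemma Li_csum m z : Li m z = csum (pow_term 0 m z).
Proof. by congr csum; apply/funext => n; rewrite /pow_term subr0. Qed.

Lemma Li_cvg m z : `|z| = 1 -> (0 < m)%N -> (m, z) <> (1%N, 1) ->
  exists2 B, cvgC (fun n => \sum_(0 <= k < n) pow_term 0 m z k) (Li m z) &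
    forall n, `|\sum_(0 <= k < n) pow_term 0 m z k - Li m z| <= B / n.+1%:R.
Proof. by move=> *; rewrite Li_csum; exact: pow_series_cvg. Qed.

Lemma ti_cvg m z : `|z| = 1 -> (0 < m)%N -> (m, z) <> (1%N, 1) ->
  cvgC (fun n => \sum_(0 <= k < n) pow_term 2%:R^-1 m z k) (ti m z).
Proof.
by move=> z1 m0 mz; have [] := pow_series_cvg half_bounds z1 m0 mz.
Qed.

(** The inner sum is split into its limit [Li p z1], which contributes a multiple of [ti q z], and a
    remainder O(1/n), which makes the outer series absolutely convergent. The factor [z] appears
    because [pow_term] carries [z ^+ n.+1]. *)
Lemma Rsum_cvg p q z1 z : `|z1| = 1 -> `|z| = 1 -> (0 < p)%N -> (0 < q)%N ->
  (p, z1) <> (1%N, 1) -> (q, z) <> (1%N, 1) ->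
  cvgC (fun N => \sum_(0 <= n < N)
      pow_term 2%:R^-1 q z n * \sum_(0 <= k < n) pow_term 0 p z1 k)
    (z * Rsum p q z1 z).
Proof.
move=> hz1 hz p0 q0 pz qz.
have [B _ hB] := Li_cvg hz1 p0 pz; have hT := ti_cvg hz q0 qz.
pose Z n := \sum_(0 <= k < n) pow_term 0 p z1 k.
pose P n := pow_term 2%:R^-1 q z n.
have B0 : 0 <= B by have := hB 0; rewrite divr1; apply: le_trans.
(* The constant collects [2 ^ q] from the outer term, [B] from the tail of [Li], and 2 from the
   inverse squares. *)
have [n N nN|l hl _] := @cvgC_cauchy R
    (fun N => \sum_(0 <= n < N) P n * (Z n - Li p z1)) (2%:R ^+ q * B * 2%:R).
  rewrite (big_cat_nat (n := n)) //= addrAC subrr add0r.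
  apply: le_trans (ler_norm_sum _ _ _) _.
  have c0 : 0 <= 2%:R ^+ q * B by rewrite mulr_ge0 ?exprn_ge0.
  rewrite -[leRHS]mulrA; apply: le_trans _ (ler_wpM2l c0 (inverse_square_sum_le _ nN)).
  rewrite mulr_sumr; apply: ler_sum => k _.
  rewrite normrM expr2 invfM mulrACA; apply: ler_pM (hB k) => //.
  exact: pow_term_norm_le1.
have hPZ : cvgC (fun N => \sum_(0 <= n < N) P n * Z n) (l + Li p z1 * ti q z).
  have := cvgC_add hl (cvgC_mull (Li p z1) hT).
  congr cvgC; apply/funext => N; rewrite mulr_sumr -big_split /=.
  by apply: eq_bigr => n _; rewrite /P; ring.
have z0 : z != 0 by rewrite -normr_gt0 hz.
suff -> : Rsum p q z1 z = z^-1 * (l + Li p z1 * ti q z) by rewrite mulVKf.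
apply: cvgC_csum; have := cvgC_mull z^-1 hPZ.
congr cvgC; apply/funext => N; rewrite mulr_sumr; apply: eq_bigr => n _.
have -> : zeta_sum n p z1 = Z n.
  by rewrite /zeta_sum big_add1 /=; apply: eq_bigr => k _; rewrite /pow_term subr0.
rewrite /P /pow_term exprS -!mulrA mulKf // -natr1.
rewrite (_ : n%:R + 1 - 2%:R^-1 = n%:R + 2%:R^-1); first by ring.
by field.
Qed.

End PolylogSeries.

(** * Bilateral series over the integers *)

Section BilateralSums.
Variable R : realType.
Implicit Types (F G : int -> R[i]) (x : R[i]).

(** As [Negz n] is [- n - 1], the window is [- K <= n < K]: symmetric for the half-integers
    [n + 1/2], but with one unpaired term, at [- K], for the integers. *)
Definition bisum F (K : nat) : R[i] := \sum_(0 <= n < K) (F n%:Z + F (Negz n)).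

Lemma bisumS F K : bisum F K.+1 = bisum F K + (F K%:Z + F (Negz K)).
Proof. by rewrite /bisum big_nat_recr. Qed.

Lemma bisum_add F G : bisum (fun n => F n + G n) = fun K => bisum F K + bisum G K.
Proof.
apply/funext => K; rewrite /bisum -big_split /=; apply: eq_bigr => n _.
by rewrite addrACA.
Qed.

Lemma bisum_mull c F : bisum (fun n => c * F n) = fun K => c * bisum F K.
Proof.
apply/funext => K; rewrite /bisum mulr_sumr; apply: eq_bigr => n _.
by rewrite mulrDr.
Qed.

Lemma bisum_sum k (F : nat -> int -> R[i]) :
  bisum (fun n => \sum_(0 <= m < k) F m n) =
  fun K => \sum_(0 <= m < k) bisum (F m) K.
Proof.
apply/funext => K; rewrite /bisum exchange_big /=; apply: eq_bigr => n _.
by rewrite big_split.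
Qed.

(** A shift by one gains one boundary term of the window and loses another; both tend to 0. *)
Lemma bisum_cvg_shift F l i :
  cvgC (fun n => F n%:Z) 0 -> cvgC (fun n => F (Negz n)) 0 ->
  cvgC (bisum F) l -> cvgC (bisum (fun n => F (n + i%:Z))) l.
Proof.
elim: i F => [|i IH] F h1 h2 hF.
  by move: hF; congr (cvgC (bisum _)); apply/funext => n; rewrite addr0.
have -> : (fun n => F (n + i.+1%:Z)) = fun n => (fun m => F (m + 1)) (n + i%:Z).
  by apply/funext => n; congr F; lia.
apply: (IH (fun m => F (m + 1))).
- move/cvgC_shift: h1; congr cvgC; apply/funext => n; congr F; lia.
- apply/cvgC_shift; move: h2; congr cvgC; apply/funext => n; congr F.
  by rewrite !NegzE; lia.
apply/cvgC_shift.
have -> : (fun K => bisum (fun m => F (m + 1)) K.+1) =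
    fun K => bisum F K.+1 + (F K.+1%:Z - F (Negz K)).
  apply/funext; elim => [|K IHK].
    by rewrite /bisum !big_nat1 add0r; ring.
  rewrite bisumS IHK [in RHS]bisumS.
  have -> : Negz K.+1 + 1 = Negz K by rewrite !NegzE; lia.
  have -> : K.+1%:Z + 1 = K.+2%:Z by lia.
  ring.
rewrite -[l]addr0 -(subrr (0 : R[i])).
apply: cvgC_add; first by move/cvgC_shift: hF.
by apply: cvgC_sub => //; move/cvgC_shift: h1.
Qed.

(** With [N = n + 1/2], the summand [f(k, N)] is [zeta_bi y^-1 (p - 1) k * ti_bi (x * y) (q - 1) n].
    The value at [k = 0] is 0 because [0^-1 = 0]. *)
Definition zeta_bi x m (k : int) : R[i] := x ^ (- k) / k%:~R ^+ m.+1.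
Definition ti_bi x m (n : int) : R[i] :=
  x ^ (- (n + 1)) / (n%:~R + 2%:R^-1) ^+ m.+1.

Lemma zeta_bi_pos x m n : zeta_bi x m n.+1 = pow_term 0 m.+1 x^-1 n.
Proof. by rewrite /zeta_bi /pow_term subr0 -exprz_inv. Qed.

Lemma zeta_bi_neg x m n :
  zeta_bi x m (Negz n) = (-1) ^+ m.+1 * pow_term 0 m.+1 x n.
Proof.
rewrite /zeta_bi /pow_term subr0 NegzE opprK mulrNz [in LHS]exprNn invfM invr_sign.
by rewrite mulrCA.
Qed.

Lemma ti_bi_pos x m n : ti_bi x m n%:Z = pow_term 2%:R^-1 m.+1 x^-1 n.
Proof.
rewrite /ti_bi /pow_term -exprz_inv -[Posz n + 1]/(Posz (n + 1)) addn1.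
by congr (_ / _ ^+ _); rewrite -[n.+1%:R]natr1 -addrA; congr (_ + _); field.
Qed.

Lemma ti_bi_neg x m n : x != 0 ->
  ti_bi x m (Negz n) = (-1) ^+ m.+1 * (x^-1 * pow_term 2%:R^-1 m.+1 x n).
Proof.
move=> x0; rewrite /ti_bi /pow_term.
have -> : - (Negz n + 1) = n%:Z by rewrite NegzE; lia.
have -> : (Negz n)%:~R + 2%:R^-1 = - (n.+1%:R - 2%:R^-1) :> R[i].
  by rewrite NegzE mulrNz; ring.
by rewrite [in LHS]exprNn invfM invr_sign [x ^+ n.+1]exprS -[x * _ / _]mulrA mulKf // mulrCA.
Qed.

Lemma zeta_bi_cvg0 x m : `|x| = 1 ->
  cvgC (fun n => zeta_bi x m n%:Z) 0 /\ cvgC (fun n => zeta_bi x m (Negz n)) 0.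
Proof.
move=> x1.
have hx z : `|z| = 1 -> cvgC (fun n => pow_term 0 m.+1 z n : R[i]) 0.
  move=> z1; apply: cvgC_squeeze (_ : cvgC (fun n => 2%:R ^+ m.+1 * n.+1%:R^-1) 0).
    move=> n; rewrite subr0; apply: pow_term_norm_le1 => //.
    by rewrite lexx invr_ge0 ler0n.
  by rewrite -(mulr0 (2%:R ^+ m.+1)); apply: cvgC_mull; exact: cvgC_inv_natS.
split.
  apply/cvgC_shift; have := hx x^-1; rewrite normfV x1 invr1 => /(_ erefl).
  by congr cvgC; apply/funext => n; rewrite zeta_bi_pos.
have := cvgC_mull ((-1) ^+ m.+1) (hx x x1); rewrite mulr0.
by congr cvgC; apply/funext => n; rewrite zeta_bi_neg.
Qed.

(* For [x = 1], [m = 0] neither half converges, but the symmetric partial sums do. *)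
Lemma zeta_bi_cvg x m : `|x| = 1 ->
  cvgC (bisum (zeta_bi x m)) (Li m.+1 x^-1 - (-1) ^+ m * Li m.+1 x).
Proof.
move=> x1; apply/cvgC_shift.
have zeta0 : zeta_bi x m 0 = 0 by rewrite /zeta_bi expr0n invr0 mulr0.
have [/andP[/eqP mE /eqP xE]|mx] := boolP ((m == 0%N) && (x == 1)).
  (* The unspecified value [Li 1 1] cancels in the limit; in the partial sums the terms at [k] and
     [- k] cancel, leaving only the one at [- (K + 1)]. *)
  rewrite mE xE invr1 expr0 mul1r subrr.
  have -> : (fun K => bisum (zeta_bi 1 0) K.+1) = fun K => -1 * K.+1%:R^-1.
    apply/funext; elim => [|K IH].
      rewrite /bisum big_nat1 -[X in X + _]/(zeta_bi 1 0 0) -{1}xE -{1}mE zeta0.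
      by rewrite zeta_bi_neg /pow_term expr1n subr0 add0r !expr1 mul1r.
    rewrite bisumS IH zeta_bi_pos zeta_bi_neg.
    by rewrite /pow_term invr1 !expr1n !expr1 !subr0 !mul1r addrA mulN1r addNr add0r.
  by rewrite -(mulr0 (-1)); apply: cvgC_mull; exact: cvgC_inv_natS.
have mxP : (m.+1, x) <> (1%N, 1) by case=> m0 x0; move: mx; rewrite m0 x0 !eqxx.
have mxP' : (m.+1, x^-1) <> (1%N, 1).
  by case=> m0 x0; apply: mxP; rewrite m0 -[x]invrK x0 invr1.
have x1' : `|x^-1| = 1 by rewrite normfV x1 invr1.
have [_ h1 _] := Li_cvg x1 (ltn0Sn m) mxP.
have [_ h2 _] := Li_cvg x1' (ltn0Sn m) mxP'.
move/cvgC_shift: h1 => h1.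
have := cvgC_sub h2 (cvgC_mull ((-1) ^+ m) h1).
congr cvgC; apply/funext => K; rewrite /bisum big_split /=; congr (_ + _).
  by rewrite big_nat_recl //= zeta0 add0r; apply: eq_bigr => n _; rewrite zeta_bi_pos.
rewrite mulr_sumr -sumrN; apply: eq_bigr => n _.
by rewrite zeta_bi_neg exprS mulN1r mulNr.
Qed.

Lemma ti_bi_cvg x m : `|x| = 1 ->
  cvgC (bisum (ti_bi x m)) (ti m.+1 x^-1 - (-1) ^+ m * (x^-1 * ti m.+1 x)).
Proof.
move=> x1; have x0 : x != 0 by rewrite -normr_gt0 x1.
have [/andP[/eqP mE /eqP xE]|mx] := boolP ((m == 0%N) && (x == 1)).
  (* The unspecified value [ti 1 1] cancels likewise, and the terms at [n] and [- n - 1] are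
     opposite. *)
  rewrite mE xE invr1 expr0 !mul1r subrr.
  have -> : bisum (ti_bi 1 0) = fun=> 0; last exact: cvgC_cst.
  apply/funext => K; rewrite /bisum big1 // => n _.
  by rewrite ti_bi_pos ti_bi_neg ?oner_neq0 // invr1 mul1r expr1 mulN1r subrr.
have mxP : (m.+1, x) <> (1%N, 1) by case=> m0 x0'; move: mx; rewrite m0 x0' !eqxx.
have mxP' : (m.+1, x^-1) <> (1%N, 1).
  by case=> m0 x0'; apply: mxP; rewrite m0 -[x]invrK x0' invr1.
have x1' : `|x^-1| = 1 by rewrite normfV x1 invr1.
have h1 := ti_cvg x1 (ltn0Sn m) mxP; have h2 := ti_cvg x1' (ltn0Sn m) mxP'.
have := cvgC_sub h2 (cvgC_mull ((-1) ^+ m) (cvgC_mull x^-1 h1)).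
congr cvgC; apply/funext => K; rewrite /bisum big_split /=; congr (_ + _).
  by apply: eq_bigr => n _; rewrite ti_bi_pos.
rewrite !mulr_sumr -sumrN; apply: eq_bigr => n _.
by rewrite ti_bi_neg // exprS mulN1r mulNr.
Qed.

End BilateralSums.

(** * Two convolution bounds by harmonic means *)

Section HarmonicSums.
Variable C : numFieldType.

(** The two factors differ by [j + 1], so partial fractions telescope with that stride; the bound
    does not depend on [K]. *)
Lemma sum_inv_shift_le j K :
  \sum_(0 <= n < K) (n.+1%:R * (n + j.+1).+1%:R)^-1
  <= j.+1%:R^-1 * \sum_(0 <= n < j.+1) n.+1%:R^-1 :> C.
Proof.
pose v n : C := n.+1%:R^-1.
have -> : \sum_(0 <= n < K) (n.+1%:R * (n + j.+1).+1%:R)^-1 =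
    j.+1%:R^-1 * \sum_(0 <= n < K) (v n - v (n + j.+1)%N).
  rewrite mulr_sumr; apply: eq_bigr => n _; rewrite /v -addSn natrD.
  by field; rewrite -[1]/(1%:R) -!natrD !pnatr_eq0.
rewrite ler_wpM2l ?invr_ge0 // sumrB lerBlDr.
have split m1 m2 : \sum_(0 <= n < m1 + m2) v n =
    \sum_(0 <= n < m1) v n + \sum_(0 <= n < m2) v (n + m1)%N.
  rewrite (big_cat_nat (n := m1)) ?leq_addr //=; congr (_ + _).
  by rewrite -{1}[m1]add0n big_addn addKn.
rewrite -split addnC split lerDl; apply: sumr_ge0 => n _.
by rewrite /v invr_ge0.
Qed.

(** The two factors [s] and [t] add up to [j + 2], so [1/(s t) = (1/s + 1/t)/(j + 2)], and both
    resulting sums are the same harmonic sum. *)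
Lemma sum_inv_rev_le j :
  \sum_(0 <= n < j.+1) (n.+1%:R * (j.+1 - n)%:R)^-1
  <= 2%:R * (j.+1%:R^-1 * \sum_(0 <= n < j.+1) n.+1%:R^-1) :> C.
Proof.
have -> : \sum_(0 <= n < j.+1) (n.+1%:R * (j.+1 - n)%:R)^-1 =
    j.+2%:R^-1 * \sum_(0 <= n < j.+1) (n.+1%:R^-1 + (j.+1 - n)%:R^-1) :> C.
  rewrite mulr_sumr; apply: eq_big_nat => n /andP[_ nj].
  have -> : j.+2%:R = n.+1%:R + (j.+1 - n)%:R :> C.
    by rewrite -natrD; congr (_%:R); lia.
  have h : (j.+1 - n)%:R != 0 :> C by rewrite pnatr_eq0; lia.
  have h' : n.+1%:R + (j.+1 - n)%:R != 0 :> C by rewrite -natrD pnatr_eq0.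
  have h'' : n.+1%:R != 0 :> C by rewrite pnatr_eq0.
  move: (n.+1%:R) ((j.+1 - n)%:R) h h' h'' => s t h h' h''.
  by field; rewrite h h' h''.
rewrite big_split /= [X in _ + X]big_nat_rev /=.
rewrite [X in _ + X](eq_big_nat _ _ (F2 := fun n => n.+1%:R^-1)); last first.
  by move=> n /andP[_ nj]; congr (_%:R^-1); lia.
set H := \sum_(_ <= _ < _) _.
have H0 : 0 <= H by apply: sumr_ge0 => n _; rewrite invr_ge0.
rewrite -[H + H]mulr2n -[H *+ 2]mulr_natl mulrCA ler_wpM2l // ler_wpM2r //.
by rewrite lef_pV2 ?posrE ?ltr0n // ler_nat.
Qed.

End HarmonicSums.

(** * Comparison of rows and columns on a finite strip *)

Section StripSummation.
Variable C : numFieldType.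
Variables (g : int -> C) (h1 h2 : nat -> C) (L L' B D : C).
Hypothesis g0 : g 0 = 0.

(** The discrete primitive of [g] with [prim 0 = 0]; below 0 the sum is oriented, and [g 0 = 0]
    gives [prim (-1) = 0]. *)
Definition prim (n : int) : C :=
  match n with
  | Posz n => \sum_(0 <= k < n) g k.+1
  | Negz n => - \sum_(0 <= k < n) g (Negz k)
  end.

#[global] Arguments prim : simpl never.

Lemma primS n : prim (n + 1) = prim n + g (n + 1).
Proof.
case: n => [n|[|n]].
- by rewrite -[Posz n + 1]/(Posz (n + 1)) addn1 /prim /= big_nat_recr.
- by rewrite /prim /= !big_geq // oppr0 add0r g0.
- have -> : Negz n.+1 + 1 = Negz n by rewrite !NegzE; lia.
  by rewrite /prim big_nat_recr //= opprD subrK.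
Qed.

Lemma sum_prim n J : \sum_(0 <= i < J) g (n + i%:Z + 1) = prim (n + J%:Z) - prim n.
Proof.
elim: J => [|J IH]; first by rewrite big_geq // addr0 subrr.
rewrite big_nat_recr //= IH.
have -> : n + J.+1%:Z = n + J%:Z + 1 by lia.
by rewrite primS addrAC.
Qed.

Hypothesis h1_le : forall n, `|h1 n| <= D / n.+1%:R.
Hypothesis h2_le : forall n, `|h2 n| <= D / n.+1%:R.
Hypothesis h2_tail : forall n N, (n <= N)%N ->
  `|\sum_(n <= k < N) h2 k| <= D / n.+1%:R.
Hypothesis prim_pos : forall n : nat, `|prim n - L| <= B / n.+1%:R.
Hypothesis prim_neg : forall n : nat, `|prim (Negz n) + L'| <= B / n.+1%:R.

(** Column [n] of the strip adds up to [prim (n + J) - prim n], so replacing it by the full column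
    [L - prim n] costs [prim (n + J) - L]. The bound is free of [K], which may then go to
    infinity. *)
Lemma strip_sum_le j K :
  `|\sum_(0 <= i < j.+1) \sum_(0 <= n < j.+1 + K)
       (h1 n * g (n%:Z + i%:Z + 1) + h2 n * g (Negz n + i%:Z + 1))
    - \sum_(0 <= n < j.+1 + K)
       (h1 n * (L - prim n) + h2 n * (L - prim (Negz n)))|
  <= 4%:R * (D * B) * (j.+1%:R^-1 * \sum_(0 <= n < j.+1) n.+1%:R^-1)
     + `|L + L'| * (D / j.+2%:R).
Proof.
set J := j.+1; set H := j.+1%:R^-1 * _.
have D0 : 0 <= D by have := h1_le 0; rewrite divr1; apply: le_trans.
have B0 : 0 <= B by have := prim_pos 0; rewrite divr1; apply: le_trans.
have mulle (s t : C) (m1 m2 : nat) : `|s| <= D / m1.+1%:R -> `|t| <= B / m2.+1%:R ->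
    `|s * t| <= D * B * (m1.+1%:R * m2.+1%:R)^-1.
  by move=> hs ht; rewrite normrM invfM mulrACA; apply: ler_pM.
rewrite exchange_big /= -sumrB.
rewrite (eq_bigr (fun n => h1 n * (prim (n%:Z + J%:Z) - L)
  + h2 n * (prim (Negz n + J%:Z) - L))); last first.
  move=> n _; rewrite big_split /= -!mulr_sumr !sum_prim; ring.
rewrite big_split /= [X in _ + X](big_cat_nat (n := J)) ?leq_addr //=.
have shift (f : nat -> C) :
    \sum_(J <= n < J + K) f n = \sum_(0 <= n < K) f (n + J)%N.
  by rewrite -{1}[J]add0n big_addn addKn.
rewrite [X in _ + (_ + X)]shift.
(* For columns below [- J], the value [prim (n + J)] is near [- L'] instead of [L]. The constant
   [- (L + L')] is split off and controlled by the tail of [h2]. *)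
rewrite [X in _ + (_ + X)](eq_bigr (fun n => - (L + L') * h2 (n + J)%N
    + h2 (n + J)%N * (prim (Negz n) + L'))); last first.
  move=> n _; have -> : Negz (n + J) + J%:Z = Negz n by rewrite !NegzE; lia.
  by ring.
rewrite big_split /= -mulr_sumr.
rewrite -shift.
have b1 : `|\sum_(0 <= n < J + K) h1 n * (prim (n%:Z + J%:Z) - L)| <= D * B * H.
  apply: le_trans (ler_norm_sum _ _ _) _.
  apply: le_trans _ (ler_wpM2l (mulr_ge0 D0 B0) (sum_inv_shift_le C j (J + K))).
  rewrite mulr_sumr; apply: ler_sum => n _.
  by apply: mulle; [exact: h1_le | exact: (prim_pos (n + J))].
have b2 : `|\sum_(0 <= n < J) h2 n * (prim (Negz n + J%:Z) - L)| <= D * B * (2%:R * H).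
  apply: le_trans (ler_norm_sum _ _ _) _.
  apply: le_trans _ (ler_wpM2l (mulr_ge0 D0 B0) (sum_inv_rev_le C j)).
  rewrite mulr_sumr big_nat [leRHS]big_nat; apply: ler_sum => n /andP[_ nj].
  have -> : Negz n + J%:Z = (j - n)%N by rewrite NegzE; lia.
  by rewrite subSn //; apply: mulle; [exact: h2_le | exact: prim_pos].
have b3 : `|\sum_(0 <= n < K) h2 (n + J)%N * (prim (Negz n) + L')| <= D * B * H.
  apply: le_trans (ler_norm_sum _ _ _) _.
  apply: le_trans _ (ler_wpM2l (mulr_ge0 D0 B0) (sum_inv_shift_le C j K)).
  rewrite mulr_sumr; apply: ler_sum => n _; rewrite [n.+1%:R * _]mulrC.
  by apply: mulle; [exact: h2_le | exact: prim_neg].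
have b4 : `|- (L + L') * \sum_(J <= n < J + K) h2 n| <= `|L + L'| * (D / j.+2%:R).
  by rewrite normrM normrN ler_wpM2l // h2_tail ?leq_addr.
have -> : 4%:R * (D * B) * H = D * B * H + D * B * (2%:R * H) + D * B * H by ring.
rewrite -!addrA; apply: le_trans (ler_normD _ _) (lerD b1 _).
apply: le_trans (ler_normD _ _) (lerD b2 _).
rewrite [leRHS]addrC.
by apply: le_trans (ler_normD _ _) (lerD b4 b3).
Qed.

End StripSummation.

(** * Evaluation of the rows *)

Section StripRows.
Variable R : realType.
Variables (x y : R[i]) (p' q' : nat).
Local Notation p := p'.+1.
Local Notation q := q'.+1.
Hypotheses (x1 : `|x| = 1) (y1 : `|y| = 1).

Let x0 : x != 0. Proof. by rewrite -normr_gt0 x1. Qed.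
Let y0 : y != 0. Proof. by rewrite -normr_gt0 y1. Qed.

Let xy1 : `|x * y| = 1. Proof. by rewrite normrM x1 y1 mulr1. Qed.

(** The factor that depends only on the row [k - N = i + 1/2]. *)
Definition half_term (z : R[i]) c (i : nat) : R[i] :=
  z ^+ i / (i%:R + 2%:R^-1) ^+ c.

Lemma half_term_cvg z c : `|z| = 1 -> (0 < c)%N -> (c, z) <> (1%N, 1) ->
  cvgC (fun J => \sum_(0 <= i < J) half_term z c i) (z^-1 * ti c z).
Proof.
move=> z1 c0 cz; have z0 : z != 0 by rewrite -normr_gt0 z1.
have := cvgC_mull z^-1 (ti_cvg z1 c0 cz).
congr cvgC; apply/funext => J; rewrite mulr_sumr; apply: eq_bigr => i _.
rewrite /pow_term /half_term exprS -!mulrA mulKf //; congr (_ / _ ^+ _).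
by rewrite -[i.+1%:R]natr1 -addrA; congr (_ + _); field.
Qed.

Lemma intr_half_neq0 (n : int) : n%:~R + 2%:R^-1 != 0 :> R[i].
Proof.
have -> : n%:~R + 2%:R^-1 = (n * 2 + 1)%:~R / 2%:R :> R[i].
  by rewrite rmorphD rmorphM /=; field.
by rewrite mulf_neq0 ?invr_neq0 ?pnatr_eq0 // intr_eq0; lia.
Qed.

(** Partial fractions with [k = n + i + 1], [b = n + 1/2], [a = i + 1/2]. The numerator equals both
    [x^(-(n+1)) y^i] and [x^(-k) (x y)^i], which suit the poles in [b] and in [k] respectively. *)
Lemma strip_term (n : int) (i : nat) :
  ti_bi (x * y) q' n * zeta_bi y^-1 p' (n + i%:Z + 1) =
    (-1) ^+ q * \sum_(0 <= m < p) 'C(p + q - m - 2, q - 1)%:R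
      * half_term (x * y) (p + q - m - 1) i * zeta_bi x m (n + i.+1%:Z)
  - (-1) ^+ q * \sum_(0 <= m < q) 'C(p + q - m - 2, p - 1)%:R
      * half_term y (p + q - m - 1) i * ((-1) ^+ m * ti_bi x m n)
  - (-1) ^+ q * 'C(p + q - 1, p)%:R * half_term (x * y) (p + q) i
      * (n == Negz i)%:R.
Proof.
rewrite /ti_bi /zeta_bi.
have -> : n + i%:Z + 1 = n + i.+1%:Z by lia.
set k : R[i] := (n + i.+1%:Z)%:~R; set b : R[i] := n%:~R + 2%:R^-1.
set a : R[i] := i%:R + 2%:R^-1.
have kE : k = a + b.
  rewrite /k /a /b rmorphD /= -[(Posz i.+1)%:~R]/(i.+1%:R) -[i.+1%:R]natr1.
  by field.
have a0 : a != 0 by exact: (intr_half_neq0 i).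
have b0 : b != 0 by exact: intr_half_neq0.
have k0 : (k == 0) = (n == Negz i).
  by rewrite /k intr_eq0 NegzE addr_eq0.
set X := x ^ (- (n + 1)).
have xyE : (x * y) ^ (- (n + 1)) * y^-1 ^ (- (n + i.+1%:Z)) = X * y ^+ i.
  rewrite expfzMl -/X -mulrA exprz_inv opprK -expfzDr //; congr (_ * _).
  by rewrite (_ : _ + _ = i%:Z) //; lia.
have xkE : X = x ^+ i * x ^ (- (n + i.+1%:Z)).
  by rewrite exprnP -expfzDr // /X; congr (_ ^ _); lia.
rewrite mulrACA xyE [(b ^+ _)^-1 * _]mulrC.
rewrite (partial_fractions _ _ a0 b0 kE) // k0 !mulrBr; congr (_ - _ - _).
- rewrite mulrCA; congr (_ * _); rewrite mulr_sumr; apply: eq_bigr => m _.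
  rewrite /half_term exprMn xkE -/a; ring.
- rewrite mulrCA; congr (_ * _); rewrite mulr_sumr; apply: eq_bigr => m _.
  rewrite /half_term -/a; ring.
- case: eqP => [nE|_]; last by rewrite !mul0r !mulr0.
  have -> : X = x ^+ i.
    by rewrite /X nE exprnP; congr (_ ^ _); rewrite NegzE; lia.
  by rewrite /half_term exprMn -/a; ring.
Qed.

Let zl m := Li m.+1 x^-1 - (-1) ^+ m * Li m.+1 x.
Let tl m := ti m.+1 x^-1 - (-1) ^+ m * (x^-1 * ti m.+1 x).

Definition strip_row (i : nat) : R[i] :=
    (-1) ^+ q * \sum_(0 <= m < p) 'C(p + q - m - 2, q - 1)%:R
      * half_term (x * y) (p + q - m - 1) i * zl m
  - (-1) ^+ q * \sum_(0 <= m < q) 'C(p + q - m - 2, p - 1)%:R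
      * half_term y (p + q - m - 1) i * ((-1) ^+ m * tl m)
  - (-1) ^+ q * 'C(p + q - 1, p)%:R * half_term (x * y) (p + q) i.

Lemma strip_row_cvg i :
  cvgC (bisum (fun n => ti_bi (x * y) q' n * zeta_bi y^-1 p' (n + i%:Z + 1)))
    (strip_row i).
Proof.
have -> : (fun n => ti_bi (x * y) q' n * zeta_bi y^-1 p' (n + i%:Z + 1)) =
  (fun n => (-1) ^+ q * (\sum_(0 <= m < p) 'C(p + q - m - 2, q - 1)%:R
      * half_term (x * y) (p + q - m - 1) i * zeta_bi x m (n + i.+1%:Z))
  + - (-1) ^+ q * (\sum_(0 <= m < q) 'C(p + q - m - 2, p - 1)%:R
      * half_term y (p + q - m - 1) i * ((-1) ^+ m * ti_bi x m n))
  + - ((-1) ^+ q * 'C(p + q - 1, p)%:R * half_term (x * y) (p + q) i)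
      * (n == Negz i)%:R).
  by apply/funext => n; rewrite strip_term !mulNr.
rewrite !bisum_add !bisum_mull !bisum_sum /strip_row -!mulNr.
apply: cvgC_add; first apply: cvgC_add.
- apply: cvgC_mull; apply: cvgC_sum => m _; rewrite bisum_mull.
  apply: cvgC_mull; have [h1 h2] := zeta_bi_cvg0 m x1.
  by apply: bisum_cvg_shift => //; exact: zeta_bi_cvg.
- apply: cvgC_mull; apply: cvgC_sum => m _; rewrite !bisum_mull.
  by apply: cvgC_mull; apply: cvgC_mull; exact: ti_bi_cvg.
- rewrite -[X in cvgC _ X]mulr1; apply: cvgC_mull.
  (* Once [K > i], the window contains the single index [Negz i] at which [k = 0]. *)
  apply: cvg_near_cst; exists i.+1 => // K /= iK.
  rewrite /bisum (bigD1_seq i) ?mem_index_iota ?iota_uniq //= eqxx.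
  rewrite big1 ?addr0 ?add0r // => n ni.
  by rewrite -[Negz n == _]/(n == i) (negPf ni) addr0.
Qed.

(** The exponent [p + q - m - 1] is at least [q] in the first sum and at least [p] in the second; it
    is 1 only if [q = 1], respectively [p = 1], and then the hypothesis keeps the base away from
    1. *)
Lemma strip_rows_cvg : (p, y) <> (1%N, 1) -> (q, x * y) <> (1%N, 1) ->
  cvgC (fun J => \sum_(0 <= i < J) strip_row i)
  ( (-1) ^+ q * \sum_(0 <= m < p) 'C(p + q - m - 2, q - 1)%:R * zl m
      * ((x * y)^-1 * ti (p + q - m - 1) (x * y))
  - (-1) ^+ q * \sum_(0 <= m < q) 'C(p + q - m - 2, p - 1)%:R
      * ((-1) ^+ m * tl m) * (y^-1 * ti (p + q - m - 1) y)
  - (-1) ^+ q * 'C(p + q - 1, p)%:R * ((x * y)^-1 * ti (p + q) (x * y))).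
Proof.
move=> py qxy; rewrite /strip_row.
have -> : (fun J => \sum_(0 <= i < J) strip_row i) = (fun J =>
  (-1) ^+ q * (\sum_(0 <= m < p) 'C(p + q - m - 2, q - 1)%:R * zl m
      * \sum_(0 <= i < J) half_term (x * y) (p + q - m - 1) i)
  - (-1) ^+ q * (\sum_(0 <= m < q) 'C(p + q - m - 2, p - 1)%:R
      * ((-1) ^+ m * tl m) * \sum_(0 <= i < J) half_term y (p + q - m - 1) i)
  - (-1) ^+ q * 'C(p + q - 1, p)%:R
      * \sum_(0 <= i < J) half_term (x * y) (p + q) i).
  apply/funext => J; rewrite !sumrB -!mulr_sumr; congr (_ * _ - _ * _ - _).
    rewrite exchange_big /=; apply: eq_bigr => m _; rewrite mulr_sumr.
    by apply: eq_bigr => i _; rewrite mulrAC.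
  rewrite exchange_big /=; apply: eq_bigr => m _; rewrite mulr_sumr.
  by apply: eq_bigr => i _; rewrite mulrAC.
apply: cvgC_sub; first apply: cvgC_sub.
- apply: cvgC_mull; apply: cvgC_sum => m mp; apply: cvgC_mull.
  apply: half_term_cvg => //; first by lia.
  by case=> e xyE; apply: qxy; rewrite xyE; congr (_, _); lia.
- apply: cvgC_mull; apply: cvgC_sum => m mq; apply: cvgC_mull.
  apply: half_term_cvg => //; first by lia.
  by case=> e yE; apply: py; rewrite yE; congr (_, _); lia.
- by apply: cvgC_mull; apply: half_term_cvg => //; case; lia.
Qed.

End StripRows.

(** * Evaluation of the columns and passage to the limit *)

Section StripLimit.
Variable R : realType.
Variables (x y : R[i]) (p' q' : nat).
Local Notation p := p'.+1.
Local Notation q := q'.+1.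
Hypotheses (x1 : `|x| = 1) (y1 : `|y| = 1).
Hypotheses (py : (p, y) <> (1%N, 1)) (qxy : (q, x * y) <> (1%N, 1)).

Let inv_neq1 (c : nat) (z : R[i]) : (c, z) <> (1%N, 1) -> (c, z^-1) <> (1%N, 1).
Proof. by move=> h [cE zE]; apply: h; rewrite cE -[z]invrK zE invr1. Qed.

Let y1' : `|y^-1| = 1. Proof. by rewrite normfV y1 invr1. Qed.
Let xy1 : `|x * y| = 1. Proof. by rewrite normrM x1 y1 mulr1. Qed.
Let xy1' : `|(x * y)^-1| = 1. Proof. by rewrite normfV xy1 invr1. Qed.
Let xy0 : x * y != 0. Proof. by rewrite -normr_gt0 xy1. Qed.

Let g := zeta_bi y^-1 p'.
Let h := ti_bi (x * y) q'.

Let prim_pos n : prim g (Posz n) = \sum_(0 <= k < n) pow_term 0 p y k.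
Proof.
by apply: eq_bigr => k _; rewrite /g zeta_bi_pos invrK.
Qed.

Let prim_neg n :
  prim g (Negz n) = - ((-1) ^+ p * \sum_(0 <= k < n) pow_term 0 p y^-1 k).
Proof.
rewrite /prim mulr_sumr; congr (- _).
by apply: eq_bigr => k _; rewrite /g zeta_bi_neg.
Qed.

(** The two products of [Li p y] with a [ti q], minus the left-hand side of the theorem. *)
Let column_limit : R[i] :=
  Li p y * ti q (x * y)^-1 - (x * y)^-1 * Rsum p q y (x * y)^-1
  + (-1) ^+ q * (x * y)^-1 * Li p y * ti q (x * y)
  + (-1) ^+ (p + q) * Rsum p q y^-1 (x * y).

Let columns_cvg :
  cvgC (fun K => \sum_(0 <= n < K) (h n%:Z * (Li p y - prim g n)
      + h (Negz n) * (Li p y - prim g (Negz n)))) column_limit.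
Proof.
have t1 := ti_cvg xy1 (ltn0Sn q') qxy.
have t2 := ti_cvg xy1' (ltn0Sn q') (inv_neq1 qxy).
have r1 := Rsum_cvg y1 xy1' (ltn0Sn p') (ltn0Sn q') py (inv_neq1 qxy).
have r2 := Rsum_cvg y1' xy1 (ltn0Sn p') (ltn0Sn q') (inv_neq1 py) qxy.
have -> : column_limit = Li p y * ti q (x * y)^-1
    - (x * y)^-1 * Rsum p q y (x * y)^-1
    + (-1) ^+ q * (x * y)^-1 * Li p y * ti q (x * y)
    + (-1) ^+ (p + q) * (x * y)^-1 * (x * y * Rsum p q y^-1 (x * y)).
  by rewrite /column_limit -[_ * _ * (x * y * _)]mulrA mulKf.
have := cvgC_add (cvgC_add (cvgC_sub (cvgC_mull (Li p y) t2) r1)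
  (cvgC_mull ((-1) ^+ q * (x * y)^-1 * Li p y) t1))
  (cvgC_mull ((-1) ^+ (p + q) * (x * y)^-1) r2).
congr cvgC; apply/funext => K; rewrite !mulr_sumr -sumrB -!big_split /=.
apply: eq_bigr => n _; rewrite prim_pos prim_neg /h ti_bi_pos ti_bi_neg //.
by rewrite [(-1) ^+ (p + q)]exprD; ring.
Qed.

(** For a fixed strip width the window grows to infinity, turning rows and columns into their limits
    while the error bound persists; that bound tends to 0 with the width. *)
Lemma strip_rows_cvg_columns :
  cvgC (fun J => \sum_(0 <= i < J) strip_row x y p' q' i) column_limit.
Proof.
have hb : 0 <= (2%:R^-1 : R[i]) <= 2%:R^-1 by rewrite lexx invr_ge0 ler0n.
have [B1 _ hB1] := Li_cvg y1 (ltn0Sn p') py.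
have [B2 _ hB2] := Li_cvg y1' (ltn0Sn p') (inv_neq1 py).
have [D1 D10 hD1] := pow_term_tail hb xy1 (ltn0Sn q') qxy.
have B10 : 0 <= B1 by have := hB1 0; rewrite divr1; apply: le_trans.
have B20 : 0 <= B2 by have := hB2 0; rewrite divr1; apply: le_trans.
have le_div (s t : R[i]) (n : nat) : s <= t -> s / n.+1%:R <= t / n.+1%:R.
  by move=> st; rewrite ler_wpM2r ?invr_ge0.
have norm_h (s : R[i]) : `|(-1) ^+ q * ((x * y)^-1 * s)| = `|s|.
  by rewrite !normrM xy1' normrX normrN1 expr1n !mul1r.
(* One [D] serves for single terms and for tails of [h], one [B] for both ends of [prim g]. *)
pose D : R[i] := 2%:R ^+ q + D1; pose B := B1 + B2.
have D2 : 2%:R ^+ q <= D by rewrite lerDl.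
pose L' := (-1) ^+ p * Li p y^-1.
have bound := @strip_sum_le _ g (fun n => h n%:Z) (fun n => h (Negz n))
  (Li p y) L' B D.
have {bound} bound j K := bound _ _ _ _ _ _ j K.
apply/cvgC_shift.
pose e j := 4%:R * (D * B) * (j.+1%:R^-1 * \sum_(0 <= n < j.+1) n.+1%:R^-1)
     + `|Li p y + L'| * (D * j.+2%:R^-1).
apply: (@cvgC_squeeze _ _ e); last first.
  have := cvgC_add (cvgC_mull (4%:R * (D * B)) (@cvgC_harmonic_mean R))
    (cvgC_mull `|Li p y + L'| (cvgC_mull D (iffLR (cvgC_shift _ _) (@cvgC_inv_natS R)))).
  by rewrite !mulr0 addr0.
move=> j; rewrite -[X in `|X|]subr0.
have rows : cvgC (fun K => \sum_(0 <= i < j.+1)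
    bisum (fun n => h n * g (n + i%:Z + 1)) K) (\sum_(0 <= i < j.+1) strip_row x y p' q' i).
  by apply: cvgC_sum => i _; exact: strip_row_cvg.
apply: (cvgC_dist_le (N := j.+1) (cvgC_sub rows columns_cvg)) => K jK.
rewrite subr0 -(subnKC jK); apply: bound.
- by rewrite /g /zeta_bi expr0n invr0 mulr0.
- move=> n; rewrite /h ti_bi_pos; apply: le_trans (le_div _ _ _ D2).
  exact: pow_term_norm_le1.
- move=> n; rewrite /h ti_bi_neg // norm_h; apply: le_trans (le_div _ _ _ D2).
  exact: pow_term_norm_le1.
- move=> n N nN; under eq_bigr do rewrite /h ti_bi_neg //.
  rewrite -!mulr_sumr norm_h; apply: le_trans (hD1 _ _ nN) _.
  by apply: le_div; rewrite lerDr exprn_ge0.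
- move=> n; rewrite prim_pos; apply: le_trans (hB1 n) _.
  by apply: le_div; rewrite lerDl.
- move=> n; rewrite prim_neg addrC /L' -mulrBr normrM normrX normrN1 expr1n mul1r.
  rewrite distrC; apply: le_trans (hB2 n) _.
  by apply: le_div; rewrite lerDr.
Qed.

End StripLimit.

Local Close Scope complex_scope.
Local Close Scope classical_set_scope.

Theorem theorem3p1 (R : realType) (x y : R[i]) (p q : nat)
    (hx : is_root_of_unity x) (hy : is_root_of_unity y)
    (hp : (1 <= p)%N) (hq : (1 <= q)%N)
    (hpy : (p, y) <> (1%N, 1)) (hqxy : (q, x * y) <> (1%N, 1)) :
  (x * y)^-1 * Rsum p q y (x * y)^-1
    - (-1) ^+ (p + q) * Rsum p q y^-1 (x * y)
  = Li p y * ti q (x * y)^-1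
    + (-1) ^+ q * (x * y)^-1 * Li p y * ti q (x * y)
    + (-1) ^+ q * 'C(p + q - 1, p)%:R * (x * y)^-1 * ti (p + q) (x * y)
    + (-1) ^+ q * (x * y)^-1 *
        \sum_(0 <= m < p) 'C(p + q - m - 2, q - 1)%:R
          * ((-1) ^+ m * Li m.+1 x - Li m.+1 x^-1)
          * ti (p + q - m - 1) (x * y)
    + (-1) ^+ q * y^-1 *
        \sum_(0 <= m < q) 'C(p + q - m - 2, p - 1)%:R
          * ti (p + q - m - 1) y
          * ((-1) ^+ m * ti m.+1 x^-1 - x^-1 * ti m.+1 x).
Proof.
have x1 := root_of_unity_norm hx; have y1 := root_of_unity_norm hy.
case: p q hp hq hpy hqxy => [|p'] // [|q'] // _ _ hpy hqxy.
(* The two limits of the row sums agree: the [Li]-[ti] products minus the left-hand side equal the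
   negative of the remaining right-hand terms. *)
have := cvgC_unique (strip_rows_cvg_columns x1 y1 hpy hqxy)
  (strip_rows_cvg x1 y1 hpy hqxy).
set p := p'.+1; set q := q'.+1 => E.
set S1 := \sum_(0 <= m < p) _ in E; set S2 := \sum_(0 <= m < q) _ in E.
have -> : (-1) ^+ q * (x * y)^-1 * (\sum_(0 <= m < p)
    'C(p + q - m - 2, q - 1)%:R * ((-1) ^+ m * Li m.+1 x - Li m.+1 x^-1)
    * ti (p + q - m - 1) (x * y)) = - ((-1) ^+ q * S1).
  rewrite -mulrA -mulrN; congr (_ * _); rewrite mulr_sumr -sumrN.
  by apply: eq_bigr => m _; ring.
have -> : (-1) ^+ q * y^-1 * (\sum_(0 <= m < q)
    'C(p + q - m - 2, p - 1)%:R * ti (p + q - m - 1) y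
    * ((-1) ^+ m * ti m.+1 x^-1 - x^-1 * ti m.+1 x)) = (-1) ^+ q * S2.
  rewrite -mulrA; congr (_ * _); rewrite mulr_sumr.
  apply: eq_bigr => m _; rewrite [(-1) ^+ m * (_ - _)]mulrBr signrMK; ring.
move/eqP: E; rewrite -subr_eq0 => /eqP E.
apply/eqP; rewrite -subr_eq0 -oppr_eq0 -[X in _ == X]E; apply/eqP.
move: S1 S2 {E} => S1 S2; ring.
Qed.
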